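(* Let $2\le p<3$, let $N\in\mathbb N$, $d,n\ge1$, and let $f=(f_1,\dots,f_d)$ with $f_\mu\colon\mathbb R^n\to\mathbb R^n$ of class $C^3_b$. Let $\mathbf w,\tilde{\mathbf w}$ be time series $(\mathbf w_0,\dots,\mathbf w_N)$, $(\tilde{\mathbf w}_0,\dots,\tilde{\mathbf w}_N)$ in $\mathbb R^d$ with lifts $\mathbf W=(\mathbf w,\mathbb W)$, $\tilde{\mathbf W}=(\tilde{\mathbf w},\tilde{\mathbb W})$, let $\xi,\tilde\xi\in\mathbb R^n$, and let $\mathbf x,\tilde{\mathbf x}$ solve \[ \mathbf x_{k+1}=\mathbf x_k+\sum_{\mu=1}^d f_\mu(\mathbf x_k)(\mathbf w^\mu_{k+1}-\mathbf w^\mu_k),\ \mathbf x_0=\xi,\qquad \tilde{\mathbf x}_{k+1}=\tilde{\mathbf x}_k+\sum_{\mu=1}^d f_\mu(\tilde{\mathbf x}_k)(\tilde{\mathbf w}^\mu_{k+1}-\tilde{\mathbf w}^\mu_k),\ \tilde{\mathbf x}_0=\tilde\xi . \] Then \[ \sup_{k=0,\dots,N}|\mathbf x_k-\tilde{\mathbf x}_k|\le 2c'_{p,N}\exp\!\Big(c_{p,N}\|f\|_{C^3_b}^p\big(|||\mathbf W|||^p_{p;[0,N]}+|||\tilde{\mathbf W}|||^p_{p;[0,N]}\big)\Big)\big(|\xi-\tilde\xi|+\|f\|_{C^3_b}\rho_p(\mathbf W,\tilde{\mathbf W})\big), \] where $c_{p,N}\coloneqq 2^pe^{2p}(L_p+K_p^2+K_p')^p$,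 $c'_{p,N}\coloneqq 2^{1-2/p}c_{p,N}^{1/p}$, $L_p\coloneqq 4^{3/2-2/p}\cdot7^{2-3/p}\cdot C_{p,N}$, $K_p\coloneqq 9\cdot 2^{6(1-1/p)}\big(1\vee 6^{1-1/p}8^{(1-1/p)(1-2/p)}C_{p,N}^{1-1/p}\big)$, $K_p'\coloneqq 3\cdot2^{1-2/p}(1+K_p^2)$, and $C_{p,N}\coloneqq 2^{2/p}\zeta_N(2/p)$ with $\zeta_N(s)=\sum_{j=1}^Nj^{-s}$.
   Context: $\mathbb R^n$ carries a fixed norm, $\mathbb R^d$ the $\ell^1$ norm, and $d\times d$ matrices the entrywise $\ell^1$ norm $|M|=\sum_{\mu,\nu}|M^{\mu\nu}|$; derivatives use induced operator norms. $\|f\|_{C^3_b}\coloneqq\max_{\mu}\max_{j=0,\dots,3}\|D^jf_\mu\|_\infty$. For $0\le k<l\le N$, $\mathcal S_{k,l}$ is the set of increasing integer sequences $s=(s_0=k<s_1<\dots<s_m<s_{m+1}=l)$, $\#s=m$. For a time series, $\|\mathbf w\|_{q;[k,l]}\coloneqq(\max_{s\in\mathcal S_{k,l}}\sum_{j=0}^{\#s}|\mathbf w_{s_{j+1}}-\mathbf w_{s_j}|^q)^{1/q}$; for a triangular array $(\Xi_{k,l})_{0\le k<l\le N}$, $\|\Xi\|_{q;[k,l]}\coloneqq(\max_{s\in\mathcal S_{k,l}}\sum_{j=0}^{\#s}|\Xi_{s_j,s_{j+1}}|^q)^{1/q}$. The lift of $\mathbf w$ is the array of $d\times d$ matrices $\mathbb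 W^{\mu\nu}_{k,l}\coloneqq\sum_{j=k}^{l-1}(\mathbf w^\mu_j-\mathbf w^\mu_k)(\mathbf w^\nu_{j+1}-\mathbf w^\nu_j)$, and $\mathbf W=(\mathbf w,\mathbb W)$. Define $|||\mathbf W|||_{p;[k,l]}\coloneqq\|\mathbf w\|_{p;[k,l]}+\|\mathbb W\|^{1/2}_{p/2;[k,l]}$ and $\rho_p(\mathbf W,\tilde{\mathbf W})\coloneqq\|\mathbf w-\tilde{\mathbf w}\|_{p;[0,N]}+\|\mathbb W-\tilde{\mathbb W}\|_{p/2;[0,N]}$. *)

(* Defs.v *)
From HB Require Import structures.
From mathcomp Require Import all_boot all_order all_algebra.
From mathcomp Require Import all_classical all_reals all_analysis.
Set Implicit Arguments. Unset Strict Implicit. Unset Printing Implicit Defensive.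
Import Order.TTheory GRing.Theory Num.Theory.
Import numFieldNormedType.Exports.
Local Open Scope classical_set_scope.
Local Open Scope ring_scope.

Section Defs.
Variable R : realType.

Definition is_norm (n : nat) (nrm : 'rV[R]_n -> R) : Prop :=
  [/\ forall x, 0 <= nrm x,
      forall x, nrm x = 0 -> x = 0,
      forall (a : R) x, nrm (a *: x) = `|a| * nrm x
    & forall x y, nrm (x + y) <= nrm x + nrm y].

(** Iterated directional derivatives: dder g [:: h1; ...; hj] x = D^j g(x)[hj,...,h1]. *)
Fixpoint dder (n : nat) (g : 'rV[R]_n -> 'rV[R]_n) (hs : seq 'rV[R]_n)
  : 'rV[R]_n -> 'rV[R]_n :=
  match hs with
  | [::] => g
  | h :: hs' => fun x => 'D_h (dder g hs') x
  end.

(** g is of class C^3: D^j g exists (Frechet) for j <= 3 and D^3 g is continuous. *)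
Definition C3 (n : nat) (g : 'rV[R]_n -> 'rV[R]_n) : Prop :=
  (forall hs : seq 'rV[R]_n, (size hs <= 2)%N ->
     forall x, differentiable (dder g hs) x) /\
  (forall hs : seq 'rV[R]_n, size hs = 3%N -> continuous (dder g hs)).

Definition C3b_vals (n d : nat) (nrm : 'rV[R]_n -> R)
  (f : 'I_d -> 'rV[R]_n -> 'rV[R]_n) : set R :=
  [set r | exists (mu : 'I_d) (hs : seq 'rV[R]_n) (x : 'rV[R]_n),
      [/\ (size hs <= 3)%N, all (fun h => nrm h <= 1) hs & r = nrm (dder (f mu) hs x)]].

Definition is_C3b (n d : nat) (nrm : 'rV[R]_n -> R)
  (f : 'I_d -> 'rV[R]_n -> 'rV[R]_n) : Prop :=
  (forall mu, C3 (f mu)) /\ has_ubound (C3b_vals nrm f).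

(** ||f||_{C^3_b} = max_mu max_{j<=3} sup_x ||D^j f_mu(x)||_op. *)
Definition C3b_norm (n d : nat) (nrm : 'rV[R]_n -> R)
  (f : 'I_d -> 'rV[R]_n -> 'rV[R]_n) : R := sup (C3b_vals nrm f).

Definition l1v (d : nat) (v : 'I_d -> R) : R := \sum_(mu < d) `|v mu|.
Definition l1m (d : nat) (M : 'I_d -> 'I_d -> R) : R :=
  \sum_(mu < d) \sum_(nu < d) `|M mu nu|.

(** S_{k,l}: sequences k = s_0 < s_1 < ... < s_m < s_{m+1} = l,
    represented by the list of interior points [:: s_1; ...; s_m]. *)
Definition partitions (k l : nat) : set (seq nat) :=
  [set s | path ltn k (rcons s l)].

Definition psum (q : R) (D : nat -> nat -> R) (k l : nat) (s : seq nat) : R :=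
  \sum_(r <- pairmap (fun a b => D a b `^ q) k (rcons s l)) r.

Definition pvar (q : R) (D : nat -> nat -> R) (k l : nat) : R :=
  (sup [set psum q D k l s | s in partitions k l]) `^ (q^-1).

Definition incr (d : nat) (w : nat -> 'I_d -> R) (a b : nat) : 'I_d -> R :=
  fun mu => w b mu - w a mu.

Definition lift (d : nat) (w : nat -> 'I_d -> R) (k l : nat) : 'I_d -> 'I_d -> R :=
  fun mu nu => \sum_(k <= j < l) (w j mu - w k mu) * (w j.+1 nu - w j nu).

Definition var_path (d : nat) (q : R) (w : nat -> 'I_d -> R) (k l : nat) : R :=
  pvar q (fun a b => l1v (incr w a b)) k l.

Definition var_arr (d : nat) (q : R) (Xi : nat -> nat -> 'I_d -> 'I_d -> R)
  (k l : nat) : R :=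
  pvar q (fun a b => l1m (Xi a b)) k l.

Definition rp_norm (d : nat) (p : R) (w : nat -> 'I_d -> R) (k l : nat) : R :=
  var_path p w k l + (var_arr (p / 2) (lift w) k l) `^ (2^-1).

Definition rp_dist (d : nat) (p : R) (w wt : nat -> 'I_d -> R) (N : nat) : R :=
  var_path p (fun j mu => w j mu - wt j mu) 0 N
  + var_arr (p / 2) (fun a b mu nu => lift w a b mu nu - lift wt a b mu nu) 0 N.

Definition zetaN (N : nat) (s : R) : R := \sum_(1 <= j < N.+1) (j%:R : R) `^ (- s).
Definition C_pN (p : R) (N : nat) : R := 2 `^ (2 / p) * zetaN N (2 / p).
Definition L_p (p : R) (N : nat) : R :=
  4 `^ (3 / 2 - 2 / p) * 7 `^ (2 - 3 / p) * C_pN p N.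
Definition K_p (p : R) (N : nat) : R :=
  9 * 2 `^ (6 * (1 - 1 / p)) *
  Num.max 1 (6 `^ (1 - 1 / p) * 8 `^ ((1 - 1 / p) * (1 - 2 / p))
             * C_pN p N `^ (1 - 1 / p)).
Definition K'_p (p : R) (N : nat) : R := 3 * 2 `^ (1 - 2 / p) * (1 + K_p p N ^+ 2).
Definition c_pN (p : R) (N : nat) : R :=
  2 `^ p * expR (2 * p) * (L_p p N + K_p p N ^+ 2 + K'_p p N) `^ p.
Definition c'_pN (p : R) (N : nat) : R := 2 `^ (1 - 2 / p) * c_pN p N `^ (1 / p).

End Defs.

(* Main.v *)
Require Import Defs.
From HB Require Import structures.
From mathcomp Require Import all_boot all_order all_algebra.
From mathcomp Require Import all_classical all_reals all_analysis.
From mathcomp Require Import ring lra zify.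
Set Implicit Arguments.
Unset Strict Implicit.
Unset Printing Implicit Defensive.
Import Order.TTheory GRing.Theory Num.Theory.
Import numFieldNormedType.Exports.
Local Open Scope classical_set_scope.
Local Open Scope ring_scope.

(** The constant [C_pN] contains [zeta_N(2/p)], which for finite [N] is enough to run
    Young's argument in the regime [2 <= p]: dropping the points of a partition one by one
    bounds a Riemann sum of two paths of finite p-variation by [C_pN] times the product of
    their p-variations.  The difference of the two solutions is therefore controlled by the
    paths alone, and the second-level terms of [rp_norm] and [rp_dist] are only discarded
    as nonnegative.

    Let [r = 1/p] and let [om] be a control dominating the p-variations of [w] and [wt]
    (scaled by [F = C3b_norm nrm f]) and, with total mass [al = (10 C_pN)^-p], that of
    [w - wt].  On an interval with [om <= al], an induction on the right end point shows
    that the solutions have increments at most [2 om^r] and that their difference at most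
    triples, up to an additive term.  Each minimal interval with [om > al] costs a factor
    [exp (8 om / al)], so superadditivity of [om] gives the global bound
    [3 exp (8 om(0, N) / al)]. *)

(** * Differential calculus measured in an arbitrary norm on row vectors *)

Section Norm.
Variables (R : realType) (n : nat) (nrm : 'rV[R]_n -> R).
Hypothesis nrmP : is_norm nrm.

Lemma nrm_ge0 x : 0 <= nrm x. Proof. by case: nrmP. Qed.
Lemma nrm_triangle x y : nrm (x + y) <= nrm x + nrm y. Proof. by case: nrmP. Qed.
Lemma nrmZ a x : nrm (a *: x) = `|a| * nrm x. Proof. by case: nrmP. Qed.
Lemma nrm0_eq0 x : nrm x = 0 -> x = 0. Proof. by case: nrmP => _ h _ _; apply: h. Qed.
Lemma nrm0 : nrm 0 = 0. Proof. by rewrite -(scale0r 0) nrmZ normr0 mul0r. Qed.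
Lemma nrmN x : nrm (- x) = nrm x.
Proof. by rewrite -scaleN1r nrmZ normrN1 mul1r. Qed.
Lemma nrm_distC x y : nrm (x - y) = nrm (y - x).
Proof. by rewrite -opprB nrmN. Qed.

Lemma nrm_sum (I : Type) (r : seq I) (F : I -> 'rV[R]_n) :
  nrm (\sum_(i <- r) F i) <= \sum_(i <- r) nrm (F i).
Proof.
elim/big_rec2: _ => [|i y1 y2 _ le12]; first by rewrite nrm0.
by apply: le_trans (nrm_triangle _ _) _; rewrite lerD2l.
Qed.

(** Differentiability refers to the sup norm of matrices; this half of the equivalence of norms
    transfers its error terms to [nrm]. *)
Lemma nrm_le_mx_norm : exists2 c : R, 0 < c & forall x, nrm x <= c * `|x|.
Proof.
exists (1 + \sum_(i < n) nrm (delta_mx 0 i)).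
  by rewrite ltr_wpDr// sumr_ge0// => i _; exact: nrm_ge0.
move=> x; rewrite {1}(row_sum_delta x).
apply: le_trans (nrm_sum _ _) _.
rewrite mulrDl mul1r ler_wpDl// mulr_suml ler_sum// => i _.
rewrite nrmZ mulrC ler_wpM2l ?nrm_ge0//.
by rewrite [leRHS]mx_normrE; exact: (le_bigmax_cond _ (fun ij => `|x ij.1 ij.2|) (j := (0, i))).
Qed.

(** First-order expansion along the single direction [u]. The candidate derivative [dg] is a
    parameter, so that differences of derivatives at shifted points fit as well. *)
Definition expansion (g dg : 'rV[R]_n -> 'rV[R]_n) (u : 'rV[R]_n) := forall x eps,
  0 < eps -> exists2 del : R, 0 < del & forall s, `|s| < del ->
    nrm (g (x + s *: u) - g x - s *: dg x) <= eps * `|s|.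

Lemma expansion_derive g u : (forall x, differentiable g x) ->
  expansion g (fun x => 'D_u g x) u.
Proof.
move=> dg x eps eps0; have [c c0 cP] := nrm_le_mx_norm.
have /derivable_nbhs/eqaddoP : derivable g x u by exact: diff_derivable.
move=> /(_ (eps / c) (divr_gt0 eps0 c0)) /nbhs_ballP[del /= del0 delP].
exists del => // s sdel.
have /= := delP s; rewrite /ball/= sub0r normrN => /(_ sdel) H.
apply: le_trans (cP _) _.
rewrite -ler_pdivlMl// mulrC mulrAC.
apply: le_trans H; rewrite le_eqVlt; apply/orP; left; apply/eqP; congr (`| _ |).
by rewrite /= /cst /= !fctE /= [x + _]addrC opprD addrA.
Qed.

(** Continuous induction: the supremum of the times up to which the bound with slope [M + eps] holds
    satisfies it too, and can be pushed to the right unless it equals [T]. *)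
Lemma mean_value_le (phi : R -> 'rV[R]_n) (M T : R) : 0 <= M -> 0 <= T ->
  (forall t eps, 0 < eps -> exists2 del : R, 0 < del & forall s, `|s| < del ->
     nrm (phi (t + s) - phi t) <= (M + eps) * `|s|) ->
  nrm (phi T - phi 0) <= M * T.
Proof.
move=> M0 T0 H; apply/ler_addgt0Pr => e e0.
(* This gives [eps * T <= e]; the [1 +] keeps the divisor positive at [T = 0]. *)
pose eps := e / (1 + T); have T1 : 0 < 1 + T by lra.
have eps0 : 0 < eps by exact: divr_gt0.
suff: nrm (phi T - phi 0) <= (M + eps) * T.
  move/le_trans; apply; rewrite mulrDl lerD2l /eps mulrAC ler_pdivrMr//.
  by rewrite ler_pM2l//; lra.
pose good t := nrm (phi t - phi 0) <= (M + eps) * t.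
pose S := [set t | 0 <= t <= T /\ forall u, 0 <= u <= t -> good u].
have S0 : S 0.
  split=> [|u]; first by lra.
  by rewrite -eq_le => /eqP <-; rewrite /good subrr nrm0 mulr0.
have Sne : S !=set0 by exists 0.
have Sub : has_ubound S by exists T => t [/andP[]].
have supS0 : 0 <= sup S by exact: ub_le_sup.
have supST : sup S <= T by apply: ge_sup; [by []|move=> t [/andP[]]].
have [del del0 delP] := H (sup S) _ eps0.
have [t St tlt] : exists2 t, S t & sup S - del < t.
  by apply: sup_adherent del0 _; split.
have tsup : t <= sup S by exact: ub_le_sup.
have [[/andP[t0 tT] goodt] Meps] : S t /\ 0 < M + eps by split => //; lra.
have goodS : good (sup S).
  have := delP (t - sup S); rewrite ler0_norm ?subr_le0// [sup S + _]addrC subrK.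
  move=> /(_ ltac:(lra)) h1; have := goodt t ltac:(lra); rewrite /good => h2.
  rewrite /good; have -> : phi (sup S) - phi 0 = phi (sup S) - phi t + (phi t - phi 0).
    by rewrite addrA subrK.
  apply: le_trans (nrm_triangle _ _) _; rewrite nrm_distC.
  have -> : (M + eps) * sup S = (M + eps) * - (t - sup S) + (M + eps) * t by ring.
  exact: lerD.
have goodr u : sup S <= u -> u < sup S + del -> good u.
  move=> su ud; have := delP (u - sup S); rewrite ger0_norm ?subr_ge0//.
  rewrite [sup S + _]addrC subrK => /(_ ltac:(lra)) h1.
  rewrite /good; have -> : phi u - phi 0 = phi u - phi (sup S) + (phi (sup S) - phi 0).
    by rewrite addrA subrK.
  apply: le_trans (nrm_triangle _ _) _.
  have -> : (M + eps) * u = (M + eps) * (u - sup S) + (M + eps) * sup S by ring.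
  exact: lerD.
have goodl u : 0 <= u < sup S -> good u.
  move=> /andP[u0 us]; have [t' [_ St'] ut'] : exists2 t', S t' & u < t'.
    have su0 : 0 < sup S - u by lra.
    have [|t' St' ] := sup_adherent su0 (E := S); first by split=> //.
    by rewrite opprB addrC subrK; exists t'.
  by apply: St'; lra.
have : sup S = T.
  apply/eqP; rewrite eq_le supST leNgt; apply/negP => sT.
  pose v := Num.min T (sup S + del / 2).
  have vT : v <= T by rewrite ge_min lexx.
  have vd : v <= sup S + del / 2 by rewrite ge_min lexx orbT.
  have vs : sup S < v by rewrite lt_min sT; lra.
  suff : S v by move=> /(ub_le_sup Sub); lra.
  split; first by lra.
  move=> u uv; have [us|us] := ltP u (sup S); first by apply: goodl; lra.
  by apply: goodr; lra.
by move=> <-.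
Qed.

(** The segment from [x] to [y] is parametrised by its [nrm]-length: the direction then has norm
    [1], and the mean value inequality applies with slope [M]. *)
Lemma lipschitz_expansion (g : 'rV[R]_n -> 'rV[R]_n)
    (dg : 'rV[R]_n -> 'rV[R]_n -> 'rV[R]_n) (M : R) : 0 <= M ->
  (forall u, expansion g (dg u) u) ->
  (forall u x, nrm u <= 1 -> nrm (dg u x) <= M) ->
  forall x y, nrm (g y - g x) <= M * nrm (y - x).
Proof.
move=> M0 gdg dgM x y; have [xy|xy] := eqVneq (nrm (y - x)) 0.
  have /eqP := nrm0_eq0 xy; rewrite subr_eq0 => /eqP ->.
  by rewrite !subrr nrm0 mulr0.
have T0 : 0 < nrm (y - x) by rewrite lt_neqAle eq_sym xy nrm_ge0.
set T := nrm (y - x) in xy T0 *; pose u := T^-1 *: (y - x).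
have u1 : nrm u = 1 by rewrite nrmZ ger0_norm ?invr_ge0 ?ltW// mulVf.
pose phi t := g (x + t *: u).
have -> : g y = phi T.
  by rewrite /phi /u scalerA divff// scale1r addrC subrK.
have -> : g x = phi 0 by rewrite /phi scale0r addr0.
apply: mean_value_le => //; first exact: ltW.
move=> t eps eps0; have [del del0 delP] := gdg u (x + t *: u) eps eps0.
exists del => // s /delP; rewrite -[_ + _ + s *: u]addrA -scalerDl -/(phi _) -/(phi _) => h.
rewrite -[phi _ - _](subrK (s *: dg u (x + t *: u))).
apply: le_trans (nrm_triangle _ _) _; rewrite mulrDl addrC lerD//.
by rewrite nrmZ mulrC ler_wpM2r// dgM// u1.
Qed.

(** * Bounds for the vector fields and their increments *)

Section VectorField.
Variables (d : nat) (f : 'I_d -> 'rV[R]_n -> 'rV[R]_n).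
Hypothesis fP : is_C3b nrm f.
Local Notation F := (C3b_norm nrm f).

Lemma dder_le (mu : 'I_d) hs x : (size hs <= 3)%N -> all (fun h => nrm h <= 1) hs ->
  nrm (dder (f mu) hs x) <= F.
Proof. by move=> hs3 hs1; apply: ub_le_sup; [exact: fP.2|exists mu, hs, x]. Qed.

Lemma field_le mu x : nrm (f mu x) <= F.
Proof. exact: (@dder_le mu [::]). Qed.

Lemma C3b_norm_ge0 : (0 < d)%N -> 0 <= F.
Proof. by move=> d0; apply: le_trans (field_le (Ordinal d0) 0); exact: nrm_ge0. Qed.

Lemma C3b_norm_mu_ge0 (mu : 'I_d) : 0 <= F.
Proof. by apply: C3b_norm_ge0; apply: leq_ltn_trans (ltn_ord mu). Qed.

Lemma field_lipschitz mu x y : nrm (f mu y - f mu x) <= F * nrm (y - x).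
Proof.
apply: (@lipschitz_expansion _ (fun u => dder (f mu) [:: u])) => [|u|u z u1].
- exact: C3b_norm_mu_ge0.
- by apply: expansion_derive => z; exact: ((fP.1 mu).1 [::]).
- by apply: dder_le => //=; rewrite u1.
Qed.

Lemma dfield_lipschitz mu u x y : nrm u <= 1 ->
  nrm (dder (f mu) [:: u] y - dder (f mu) [:: u] x) <= F * nrm (y - x).
Proof.
move=> u1; apply: (@lipschitz_expansion _ (fun v => dder (f mu) [:: v; u])) => [|v|v z v1].
- exact: C3b_norm_mu_ge0.
- by apply: expansion_derive => z; exact: ((fP.1 mu).1 [:: u]).
- by apply: dder_le => //=; rewrite u1 v1.
Qed.

(** Mean value inequality in the base point: the derivative of [z |-> f mu (z + v) - f mu z] is a
    difference of first derivatives, at most [F * nrm v] by [dfield_lipschitz]. *)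
Lemma field_second_difference mu v a b :
  nrm ((f mu (a + v) - f mu a) - (f mu (b + v) - f mu b)) <= F * nrm v * nrm (a - b).
Proof.
pose g z := f mu (z + v) - f mu z.
apply: (@lipschitz_expansion g
  (fun u z => dder (f mu) [:: u] (z + v) - dder (f mu) [:: u] z)).
- by rewrite mulr_ge0 ?nrm_ge0// C3b_norm_mu_ge0.
- move=> u z eps eps0; have e2 : 0 < eps / 2 by lra.
  have ex : expansion (f mu) (dder (f mu) [:: u]) u.
    by apply: expansion_derive => y; exact: ((fP.1 mu).1 [::]).
  have [d1 d10 d1P] := ex (z + v) _ e2.
  have [d2 d20 d2P] := ex z _ e2.
  exists (Num.min d1 d2); first by rewrite lt_min d10.
  move=> s; rewrite lt_min => /andP[/d1P h1 /d2P h2].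
  have -> : g (z + s *: u) - g z - s *: (dder (f mu) [:: u] (z + v) - dder (f mu) [:: u] z)
      = (f mu (z + v + s *: u) - f mu (z + v) - s *: dder (f mu) [:: u] (z + v))
      - (f mu (z + s *: u) - f mu z - s *: dder (f mu) [:: u] z).
    by rewrite /g scalerBr [z + v + _]addrAC; apply/rowP => i; rewrite !mxE; ring.
  apply: le_trans (nrm_triangle _ _) _; rewrite nrmN [leRHS](splitr _) -mulrA.
  by have := lerD h1 h2; lra.
- move=> u z u1; apply: le_trans (dfield_lipschitz mu z (z + v) u1) _.
  by rewrite [z + v]addrC addrK.
Qed.

End VectorField.
End Norm.

(** * Controls and sums along partitions *)

Definition is_control (R : realType) (om : nat -> nat -> R) : Prop :=
  (forall a b, 0 <= om a b) /\
  (forall a b c, (a <= b <= c)%N -> om a b + om b c <= om a c).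

Definition chain_sum (V : zmodType) (A : nat -> nat -> V) (a b : nat) (s : seq nat) : V :=
  \sum_(r <- pairmap A a (rcons s b)) r.

Section Control.
Variables (R : realType) (om : nat -> nat -> R).
Hypothesis omP : is_control om.

Lemma control_ge0 a b : 0 <= om a b. Proof. exact: omP.1. Qed.

Lemma control_mono a' b' a b : (a <= a')%N -> (a' <= b')%N -> (b' <= b)%N ->
  om a' b' <= om a b.
Proof.
move=> aa ab bb.
have h1 := omP.2 a a' b' ltac:(lia).
have h2 := omP.2 a b' b ltac:(lia).
by have := control_ge0 a a'; have := control_ge0 b' b; lra.
Qed.

Lemma path_ltn_last a b (s : seq nat) : path ltn a (rcons s b) -> (a < b)%N.
Proof.
by move=> /(order_path_min ltn_trans)/allP; apply; rewrite mem_rcons inE eqxx.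
Qed.

Lemma path_ltn_split a b (s1 s2 : seq nat) x : path ltn a (rcons (s1 ++ x :: s2) b) ->
  [/\ path ltn a (rcons (s1 ++ s2) b), (a <= last a s1)%N, (last a s1 < x)%N,
      (x < head b s2)%N & (head b s2 <= b)%N].
Proof.
rewrite !rcons_cat !cat_path /= => /and3P[p1 lx px].
have ala : (a <= last a s1)%N.
  by case: (lastP s1) p1 => // s y; rewrite last_rcons => /path_ltn_last/ltnW.
have xb := path_ltn_last px.
case: s2 px => [|y s2] /=; first by rewrite andbT p1 => _; split=> //; lia.
case/andP => xy py; rewrite p1 py andbT; split => //; try lia.
by have := path_ltn_last py; lia.
Qed.

Lemma chain_sum_nil (V : zmodType) (A : nat -> nat -> V) a b : chain_sum A a b [::] = A a b.
Proof. by rewrite /chain_sum /= big_seq1. Qed.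

Lemma chain_sum_cons (V : zmodType) (A : nat -> nat -> V) a b x s :
  chain_sum A a b (x :: s) = A a x + chain_sum A x b s.
Proof. by rewrite /chain_sum /= big_cons. Qed.

(** All terms away from [x] cancel. The defaults of [last] and [head] make [a] and [b] the
    neighbours of an extreme interior point. *)
Lemma chain_sum_remove (V : zmodType) (A : nat -> nat -> V) a b s1 x s2 :
  let l := last a s1 in let h := head b s2 in
  chain_sum A a b (s1 ++ s2) - chain_sum A a b (s1 ++ x :: s2) = A l h - A l x - A x h.
Proof.
elim: s1 a => [|y s1 IH] a /=.
  case: s2 => [|y s2] /=; rewrite !(chain_sum_nil, chain_sum_cons) ?opprD ?addrA//.
  by rewrite addrAC [X in X - _]addrAC addrK.
by rewrite !chain_sum_cons opprD addrACA subrr add0r IH.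
Qed.

(* Young's averaging: the intervals between the neighbours of the interior points cover
   [a, b] at most twice. *)
Lemma exists_light_point a b s (del : R) : path ltn a (rcons s b) -> s != [::] ->
  (exists s1 x s2, s = s1 ++ x :: s2 /\ om (last a s1) (head b s2) <= del) \/
  del * (size s)%:R < om a b + om (head b s) b.
Proof.
elim: s a => [//|x s IH] a /= /andP[ax px] _.
have [small|big] := leP (om a (head b s)) del.
  by left; exists [::], x, s.
have xb := path_ltn_last px.
case: s px IH big => [_ _|y s px IH] /= big.
  by right; have := control_ge0 x b; lra.
have [[s1 [z [s2 [-> h]]]]|h] := IH x px isT.
  by left; exists (x :: s1), z, s2.
right; move: h; rewrite /= => h.
have yb : (y < b)%N by case/andP: px => _ /path_ltn_last.
have xy : (x < y)%N by case/andP: px.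
(* The interval [[a, y]] around the new point [x] merges with the term [om y b] of the induction
   hypothesis into [om a b], while [om x b] is carried over as the second term. *)
have := omP.2 a y b ltac:(lia).
by rewrite -(natr1 (size s).+1) mulrDr mulr1; lra.
Qed.
End Control.

(** * Discrete sewing by removal of points *)

Section Sewing.
Variables (R : realType) (n : nat) (nrm : 'rV[R]_n -> R).
Hypothesis nrmD : forall x y, nrm (x + y) <= nrm x + nrm y.
Hypothesis nrm0 : nrm 0 = 0.
Variables (om : nat -> nat -> R) (th K : R) (A : nat -> nat -> 'rV[R]_n).
Hypothesis omP : is_control om.

Lemma chain_sum_sewing (a b : nat) (s : seq nat) : 0 <= K -> 0 <= th ->
  path ltn a (rcons s b) ->
  (forall i j k, (a <= i)%N -> (i < j)%N -> (j < k)%N -> (k <= b)%N ->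
     nrm (A i k - A i j - A j k) <= K * om i k `^ th) ->
  nrm (A a b - chain_sum A a b s) <=
    K * (2 `^ th * \sum_(1 <= j < (size s).+1) (j%:R : R) `^ (- th)) * om a b `^ th.
Proof.
move=> K0 th0 + AP; move: {2}(size s) (erefl (size s)) => m.
elim: m s => [|m IH] s sm ps.
  by rewrite sm big_geq// (size0nil sm) chain_sum_nil subrr nrm0 mulr0 mulr0 mul0r.
have s0 : s != [::] by case: s sm {ps}.
(* With this threshold the alternative without a light point reads
   [2 * om a b < om a b + om (head b s) b], against monotonicity of [om]. *)
have [[s1 [x [s2 [sE small]]]]|big] :=
    exists_light_point omP (2 * om a b / (size s)%:R) ps s0; last first.
  move: big; rewrite divfK ?pnatr_eq0 ?sm//.
  have hb : (a <= head b s)%N /\ (head b s <= b)%N.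
    case: s ps {sm s0} => [|y s] /= ; first by move=> /andP[]; lia.
    by move=> /andP[ay /path_ltn_last]; lia.
  by have := control_mono omP (a := a) (b := b) hb.1 hb.2 (leqnn b); lra.
move: ps; rewrite sE => /path_ltn_split[ps' al lx xh hb].
have sz : size (s1 ++ s2) = m.
  by move: sm; rewrite sE !size_cat/=; lia.
have /= := IH _ sz ps'; rewrite sz -sE sm => IHs.
rewrite big_nat_recr//= !mulrDr mulrDl.
rewrite -(subrK (chain_sum A a b (s1 ++ s2)) (A a b)) -addrA sE.
apply: le_trans (nrmD _ _) _; apply: lerD => //.
rewrite chain_sum_remove; apply: le_trans (AP _ _ _ _ _ _ _) _ => //.
rewrite -mulrA ler_wpM2l//.
have -> : 2 `^ th * m.+1%:R `^ (- th) * om a b `^ th = (2 * om a b / m.+1%:R) `^ th.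
  have o0 := control_ge0 omP a b.
  rewrite powRM ?mulr_ge0// powRM// -[_^-1]powR_inv1// -powRrM mulN1r; ring.
rewrite ge0_ler_powR ?nnegrE ?(control_ge0 omP)//.
  by rewrite divr_ge0// mulr_ge0// (control_ge0 omP).
by rewrite -sm.
Qed.

Lemma chain_sum_iota (V : zmodType) (B : nat -> nat -> V) a m :
  chain_sum B a (a + m.+1) (iota a.+1 m) = \sum_(a <= j < a + m.+1) B j j.+1.
Proof.
elim: m a => [|m IH] a; first by rewrite chain_sum_nil addn1 big_nat1.
rewrite /= chain_sum_cons -[in (a + m.+2)%N]addSnnS IH.
by rewrite [in RHS]big_ltn ?addSnnS//; lia.
Qed.

(** The previous bound for the finest partition of [[a, b]]; its zeta sum is extended to [N] terms
    so that the constant does not depend on the interval. *)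
Lemma discrete_sewing (N a b : nat) : 0 <= K -> 0 <= th ->
  (a < b)%N -> (b <= N)%N ->
  (forall i j k, (a <= i)%N -> (i < j)%N -> (j < k)%N -> (k <= b)%N ->
     nrm (A i k - A i j - A j k) <= K * om i k `^ th) ->
  nrm (A a b - \sum_(a <= j < b) A j j.+1) <=
    K * (2 `^ th * zetaN N th) * om a b `^ th.
Proof.

move=> K0 th0 ab bN AP; have bE : b = (a + (b - a).-1.+1)%N by lia.
rewrite [in X in _ - X]bE -chain_sum_iota -bE.
have pio : path ltn a (rcons (iota a.+1 (b - a).-1) b).
  rewrite {2}bE -[(a + _)%N]addSnnS -cats1.
  rewrite (_ : [:: _] = iota (a.+1 + (b - a).-1) 1)// -iotaD addn1.
  exact: (iota_ltn_sorted a (b - a).-1.+2).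
apply: le_trans (chain_sum_sewing K0 th0 pio AP) _.
rewrite ler_wpM2r ?powR_ge0// ler_wpM2l// ler_wpM2l ?powR_ge0//.
rewrite size_iota /zetaN [leRHS](@big_cat_nat _ _ _ (b - a).-1.+1)//=; last by lia.
by rewrite lerDl sumr_ge0// => i _; exact: powR_ge0.
Qed.
End Sewing.

(** * The power of the variation as a control *)

Section Variation.
Variables (R : realType) (q : R) (D : nat -> nat -> R).

(** The [q]-th power of [pvar]: superadditivity holds before the root is taken. *)
Definition pvarq (k l : nat) : R := sup [set psum q D k l s | s in partitions k l].

Lemma psum_ge0 k l s : 0 <= psum q D k l s.
Proof.
rewrite /psum; elim: s k => [|x s IH] k /=; first by rewrite big_seq1 powR_ge0.
by rewrite big_cons addr_ge0// powR_ge0.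
Qed.

Lemma psum_cat a b c s1 s2 :
  psum q D a c (s1 ++ b :: s2) = psum q D a b s1 + psum q D b c s2.
Proof.
rewrite /psum; elim: s1 a => [|x s IH] a /=; first by rewrite big_cons big_seq1.
by rewrite !big_cons IH addrA.
Qed.

(** Needed for [sup] to be a genuine supremum. A partition has at most [l - k] intervals, and [B]
    sums over all pairs up to [l], hence stays fixed while the left end point moves in the
    induction. *)
Lemma has_ubound_psum k l : has_ubound [set psum q D k l s | s in partitions k l].
Proof.
pose B := \sum_(i < l.+1) \sum_(j < l.+1) D i j `^ q.
have B_ge i j : (i <= l)%N -> (j <= l)%N -> D i j `^ q <= B.
  move=> il jl; rewrite /B (bigD1 (Ordinal (il : (i < l.+1)%N)))//=.
  rewrite (bigD1 (Ordinal (jl : (j < l.+1)%N)))//= -addrA lerDl addr_ge0//.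
    by apply: sumr_ge0 => ? _; exact: powR_ge0.
  by do 2![apply: sumr_ge0 => ? _]; exact: powR_ge0.
exists ((l - k)%:R * B) => _ [s + <-]; rewrite /partitions/=.
elim: s k => [|x s IH] k /=.
  rewrite andbT => kl; rewrite /psum /= big_seq1.
  apply: le_trans (B_ge k l _ _) _ => //; first exact: ltnW.
  rewrite ler_peMl ?ler1n ?subn_gt0//; apply: le_trans (B_ge l l _ _) => //.
  exact: powR_ge0.
move=> /andP[kx px]; have xl := path_ltn_last px.
rewrite (psum_cat _ _ _ [::]) /psum /= big_seq1 -/(psum q D x l s).
have -> : (l - k)%N = ((x - k) + (l - x))%N by lia.
rewrite natrD mulrDl; apply: lerD; last exact: IH.
apply: le_trans (B_ge k x _ _) _; [lia|lia|].
rewrite ler_peMl ?ler1n ?subn_gt0//; apply: le_trans (B_ge l l _ _) => //.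
exact: powR_ge0.
Qed.

Lemma partitions_nil k l : (k < l)%N -> partitions k l [::].
Proof. by move=> kl; rewrite /partitions/= kl. Qed.

(** There is no partition, and [sup] of the empty set is [0] by convention. *)
Lemma pvarq_geq k l : (l <= k)%N -> pvarq k l = 0.
Proof.
move=> lk; rewrite /pvarq (_ : [set _ | _ in _] = set0) ?sup0//.
by rewrite -subset0 => y [s /path_ltn_last]; rewrite ltnNge lk.
Qed.

Lemma pvarq_ge0 k l : 0 <= pvarq k l.
Proof.
have [/pvarq_geq ->//|kl] := leqP l k.
apply: le_trans (psum_ge0 k l [::]) _; apply: ub_le_sup; first exact: has_ubound_psum.
by exists [::] => //; exact: partitions_nil.
Qed.

(** Partitions of [[a, b]] and [[b, c]] glued at [b] form one of [[a, c]]; the two suprema are then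
    taken one after the other. *)
Lemma pvarq_control : is_control pvarq.
Proof.
split=> [|a b c /andP[]]; first exact: pvarq_ge0.
rewrite leq_eqVlt => /predU1P[<- _|ab]; first by rewrite (pvarq_geq (leqnn a)) add0r.
rewrite leq_eqVlt => /predU1P[<-|bc]; first by rewrite (pvarq_geq (leqnn b)) addr0.
rewrite -lerBrDr; apply: ge_sup.
  by exists (psum q D a b [::]); exists [::] => //; exact: partitions_nil.
move=> _ [s1 s1P <-]; rewrite lerBrDl -lerBrDr; apply: ge_sup.
  by exists (psum q D b c [::]); exists [::] => //; exact: partitions_nil.
move=> _ [s2 s2P <-]; rewrite lerBrDl -psum_cat; apply: ub_le_sup.
  exact: has_ubound_psum.
exists (s1 ++ b :: s2) => //; move: s1P s2P; rewrite /partitions/=.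
by rewrite -cat_rcons rcons_cat cat_path last_rcons => -> ->.
Qed.

Lemma le_pvarq a b : (a < b)%N -> D a b `^ q <= pvarq a b.
Proof.
move=> ab; apply: ub_le_sup; first exact: has_ubound_psum.
by exists [::]; [exact: partitions_nil|rewrite /psum/= big_seq1].
Qed.

Lemma le_pvarq_root a b : 0 < q -> 0 <= D a b -> (a < b)%N -> D a b <= pvarq a b `^ q^-1.
Proof.
move=> q0 D0 ab; have -> : D a b = (D a b `^ q) `^ q^-1.
  by rewrite -powRrM divff ?gt_eqF// powRr1.
by rewrite ge0_ler_powR ?nnegrE ?powR_ge0 ?pvarq_ge0 ?invr_ge0 ?le_pvarq ?ltW.
Qed.

Lemma pvar_powR k l : 0 < q -> pvar q D k l `^ q = pvarq k l.
Proof.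
by move=> q0; rewrite /pvar -/(pvarq k l) -powRrM mulVf ?gt_eqF// powRr1// pvarq_ge0.
Qed.

End Variation.

(** * Young's inequality for Riemann sums *)

Section Young.
Variables (R : realType) (n d : nat) (nrm : 'rV[R]_n -> R).
Hypothesis nrmP : is_norm nrm.
Variables (p : R) (N : nat) (om : nat -> nat -> R).
Hypotheses (p_gt0 : 0 < p) (omP : is_control om).
Local Notation W a b := (om a b `^ p^-1).
Local Notation C := (C_pN p N).

Lemma l1v_ge0 (c : 'I_d -> R) : 0 <= l1v c.
Proof. by apply: sumr_ge0. Qed.

Lemma nrm_lincomb_le (c : 'I_d -> R) (v : 'I_d -> 'rV[R]_n) (M : R) :
  (forall mu, nrm (v mu) <= M) -> nrm (\sum_(mu < d) c mu *: v mu) <= M * l1v c.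
Proof.
move=> vM; apply: le_trans (nrm_sum nrmP _ _) _.
rewrite /l1v mulr_sumr ler_sum// => mu _.
by rewrite (nrmZ nrmP) mulrC ler_wpM2r.
Qed.

Lemma W_mono a' b' a b : (a <= a')%N -> (a' <= b')%N -> (b' <= b)%N -> W a' b' <= W a b.
Proof.
move=> aa ab bb; rewrite ge0_ler_powR ?nnegrE ?(control_ge0 omP) ?invr_ge0 ?(ltW p_gt0)//.
exact: control_mono.
Qed.

Lemma C_pN_ge0 : 0 <= C.
Proof. by rewrite mulr_ge0 ?powR_ge0// sumr_ge0// => i _; exact: powR_ge0. Qed.

(** Sewing with exponent [2 / p] applied to [incr w i j * y i], whose defect is an increment of [w]
    times one of [y]. A left-point sum does not see [y b], so increments of [y] are controlled only
    before [b]; this lets the later inductions on the right end point close. *)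
Lemma young_bound (w : nat -> 'I_d -> R) (y : nat -> 'I_d -> 'rV[R]_n) (H K M : R) a b :
  (a < b)%N -> (b <= N)%N -> 0 <= K ->
  (forall i j mu, (a <= i)%N -> (i < j)%N -> (j < b)%N ->
     nrm (y j mu - y i mu) <= H * W i j) ->
  (forall i j, (a <= i)%N -> (i < j)%N -> (j <= b)%N ->
     H * l1v (incr w i j) <= K * W i j) ->
  (forall mu, nrm (y a mu) <= M) ->
  nrm (\sum_(a <= j < b) \sum_(mu < d) (w j.+1 mu - w j mu) *: y j mu) <=
    M * l1v (incr w a b) + K * C * W a b ^+ 2.
Proof.
move=> ab bN K0 yH wK yM.
pose A i j := \sum_(mu < d) incr w i j mu *: y i mu.
have om2 i j : om i j `^ (2 / p) = W i j ^+ 2.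
  by rewrite mulrC powRrM powR_mulrn// powR_ge0.
have nD := nrm_triangle nrmP.
have := @discrete_sewing R n nrm nD (nrm0 nrmP) om (2 / p) K A omP N a b K0.
move=> /(_ ltac:(by rewrite divr_ge0// ltW) ab bN) sew.
have {}sew : nrm (A a b - \sum_(a <= j < b) A j j.+1) <= K * C * W a b ^+ 2.
  rewrite -om2; apply: sew => i j k ai ij jk kb; rewrite om2.
  have -> : A i k - A i j - A j k = \sum_(mu < d) incr w j k mu *: (y i mu - y j mu).
    rewrite /A -!sumrB; apply: eq_bigr => mu _; rewrite /incr.
    by apply/rowP => z; rewrite !mxE; ring.
  apply: le_trans (nrm_lincomb_le _ (M := H * W i j) _) _.
    by move=> mu; rewrite (nrm_distC nrmP); apply: yH => //; lia.
  have h1 := wK j k ltac:(lia) jk kb.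
  have h2 : W i j <= W i k by apply: W_mono; lia.
  have h3 : W j k <= W i k by apply: W_mono; lia.
  have W0 := powR_ge0 (om i j) p^-1; have W1 := powR_ge0 (om j k) p^-1.
  rewrite mulrAC; apply: le_trans (ler_wpM2r W0 h1) _.
  by rewrite -mulrA ler_wpM2l// expr2 ler_pM.
rewrite -[leLHS](nrmN nrmP).
have -> : - \sum_(a <= j < b) \sum_(mu < d) (w j.+1 mu - w j mu) *: y j mu
   = (A a b - \sum_(a <= j < b) A j j.+1) + - A a b.
  by rewrite addrAC subrr add0r.
apply: le_trans (nD _ _) _; rewrite addrC lerD// (nrmN nrmP).
exact: nrm_lincomb_le.
Qed.

(** * A single solution on an interval of small control *)

Variables (f : 'I_d -> 'rV[R]_n -> 'rV[R]_n).
Hypotheses (fP : is_C3b nrm f) (d_gt0 : (0 < d)%N).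
Local Notation F := (C3b_norm nrm f).
Variable al : R.
Hypotheses (al_gt0 : 0 < al) (C_ge1 : 1 <= C) (Cal : C * al `^ p^-1 <= 1 / 10).

Definition solves (x : nat -> 'rV[R]_n) (w : nat -> 'I_d -> R) := forall k, (k < N)%N ->
  x k.+1 = x k + \sum_(mu < d) (w k.+1 mu - w k mu) *: f mu (x k).

Lemma solves_sum x w a b : solves x w -> (a <= b)%N -> (b <= N)%N ->
  x b - x a = \sum_(a <= j < b) \sum_(mu < d) (w j.+1 mu - w j mu) *: f mu (x j).
Proof.
move=> xw ab bN; rewrite -telescope_sumr//; apply: eq_big_nat => j /andP[aj jb].
by rewrite xw ?(leq_trans jb)// [x j + _]addrC addrK.
Qed.

(** On such intervals the quadratic term [C * W s t ^+ 2] of Young's bound is at most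
    [W s t / 10]. *)
Lemma W_small k l s t : (k <= s)%N -> (s <= t)%N -> (t <= l)%N -> om k l <= al ->
  C * W s t <= 1 / 10.
Proof.
move=> ks st tl kl; apply: le_trans Cal; rewrite ler_wpM2l ?C_pN_ge0//.
rewrite ge0_ler_powR ?nnegrE ?(control_ge0 omP) ?invr_ge0 ?(ltW p_gt0) ?(ltW al_gt0)//.
by apply: le_trans kl; exact: control_mono.
Qed.

(** Strong induction on [t]: the bound at earlier times feeds Young's inequality, which returns
    [W s t + 2 * C * W s t ^+ 2], at most [12/10] of [W s t]. *)
Lemma local_solution x w k l : solves x w ->
  (forall a b, (a < b)%N -> (b <= N)%N -> F * l1v (incr w a b) <= W a b) ->
  (l <= N)%N -> om k l <= al ->
  forall t s, (k <= s)%N -> (s <= t)%N -> (t <= l)%N -> nrm (x t - x s) <= 2 * W s t.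
Proof.
move=> xw wW lN kl; elim/ltn_ind => t IH s ks st tl.
have F0 : 0 <= F by exact: C3b_norm_ge0.
have W0 := powR_ge0 (om s t) p^-1.
move: st; rewrite leq_eqVlt => /predU1P[st|st].
  by rewrite st subrr (nrm0 nrmP) mulr_ge0 ?powR_ge0.
rewrite (solves_sum xw) ?(leq_trans tl)//; last exact: ltnW.
have := @young_bound w (fun j mu => f mu (x j)) (F * 2) 2 F s t st (leq_trans tl lN).
move=> H; apply: le_trans (H _ _ _ _) _ => //.
- move=> i j mu si ij jt; apply: le_trans (field_lipschitz nrmP fP mu _ _) _.
  rewrite -mulrA ler_wpM2l//.
  exact: (IH j jt i (leq_trans ks si) (ltnW ij) (leq_trans (ltnW jt) tl)).
- move=> i j si ij jt; rewrite mulrAC mulrC ler_pM2l//.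
  exact: (wW i j ij (leq_trans jt (leq_trans tl lN))).
- by move=> mu; exact: field_le.
have h1 := wW s t st (leq_trans tl lN).
have h2 := W_small ks (ltnW st) tl kl.
have h3 := ler_wpM2l W0 h2.
rewrite expr2; move: W0 h1 h3; move: (C) (W s t) (l1v _) => c v a W0 h1 h3.
by rewrite (_ : 2 * c * (v * v) = 2 * (v * (c * v))); [lra|ring].
Qed.

(** * The difference of two solutions *)

Variables (x xt : nat -> 'rV[R]_n) (w wt : nat -> 'I_d -> R) (B : R).
Local Notation h := (fun j mu => w j mu - wt j mu).
Local Notation e j := (x j - xt j).
Hypotheses (xw : solves x w) (xtwt : solves xt wt) (B_ge0 : 0 <= B).
Hypothesis wW : forall a b, (a < b)%N -> (b <= N)%N -> F * l1v (incr w a b) <= W a b.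
Hypothesis wtW : forall a b, (a < b)%N -> (b <= N)%N -> F * l1v (incr wt a b) <= W a b.
Hypothesis hW : forall a b, (a < b)%N -> (b <= N)%N -> F * l1v (incr h a b) <= B * W a b.

(** Insert [f mu (xt t + e s)]: the first part is a Lipschitz bound, the second a second difference
    with shift [e s]. *)
Lemma field_difference mu s t :
  nrm ((f mu (x t) - f mu (xt t)) - (f mu (x s) - f mu (xt s))) <=
  F * nrm (e t - e s) + F * nrm (e s) * nrm (xt t - xt s).
Proof.
have -> : (f mu (x t) - f mu (xt t)) - (f mu (x s) - f mu (xt s)) =
   (f mu (x t) - f mu (xt t + e s)) +
   ((f mu (xt t + e s) - f mu (xt t)) - (f mu (xt s + e s) - f mu (xt s))).
  rewrite [xt s + _]addrC subrK; set u1 := f mu (xt t + e s).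
  by apply/rowP => z; rewrite !mxE; ring.
apply: le_trans (nrm_triangle nrmP _ _) _; apply: lerD; last first.
  exact: field_second_difference.
apply: le_trans (field_lipschitz nrmP fP mu _ _) _.
by rewrite opprD addrA.
Qed.

(** Bilinear splitting into a sum against [w] with the difference of the fields, and a sum against
    [h] with the fields along [xt]. *)
Lemma difference_sum a b : (a <= b)%N -> (b <= N)%N ->
  e b - e a =
  \sum_(a <= j < b) \sum_(mu < d) (w j.+1 mu - w j mu) *: (f mu (x j) - f mu (xt j)) +
  \sum_(a <= j < b) \sum_(mu < d) (h j.+1 mu - h j mu) *: f mu (xt j).
Proof.
move=> ab bN; have -> : e b - e a = (x b - x a) - (xt b - xt a).
  by rewrite !opprB; apply/rowP => z; rewrite !mxE; ring.
rewrite (solves_sum xw)// (solves_sum xtwt)// -sumrB -big_split/=.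
apply: eq_bigr => j _; rewrite -sumrB -big_split/=; apply: eq_bigr => mu _.
by apply/rowP => z; rewrite !mxE; ring.
Qed.

(** The induction of [local_solution] again, with Young's inequality applied to both sums of
    [difference_sum]. *)
Lemma local_difference k l : (k <= l)%N -> (l <= N)%N -> om k l <= al ->
  forall t s, (k <= s)%N -> (s <= t)%N -> (t <= l)%N ->
  nrm (e t - e s) <= 2 * (nrm (e k) + B) * W s t.
Proof.
move=> kl lN small; have [H HE] : {H : R | H = 2 * (nrm (e k) + B)} by eexists.
rewrite -HE.
have F0 : 0 <= F by exact: C3b_norm_ge0.
have ek0 := nrm_ge0 nrmP (e k).
have hB := B_ge0.
have H0 : 0 <= H by rewrite HE; lra.
have xtW := local_solution xtwt wtW lN small.
elim/ltn_ind => t IH s ks st tl.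
have W0 := powR_ge0 (om s t) p^-1.
move: st; rewrite leq_eqVlt => /predU1P[st|st].
  by rewrite st subrr (nrm0 nrmP) mulr_ge0 ?powR_ge0.
have tN := leq_trans tl lN.
(* [S] bounds [nrm (e a)] for [k <= a < t]: the induction hypothesis allows growth [H * W k a], and
   [W k a <= C * W k a <= 1 / 10]. *)
have [S SE] : {S : R | S = nrm (e k) + H / 10} by eexists.
have S0 : 0 <= S by rewrite SE; lra.
have eS a : (k <= a)%N -> (a < t)%N -> nrm (e a) <= S.
  move=> ka at_; rewrite -(subrK (e k) (e a)) addrC.
  apply: le_trans (nrm_triangle nrmP _ _) _; rewrite SE lerD2l.
  apply: le_trans (IH a at_ k (leqnn k) ka (leq_trans (ltnW at_) tl)) _.
  have W1 := powR_ge0 (om k a) p^-1.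
  have h1 := W_small (leqnn k) ka (leq_trans (ltnW at_) tl) small.
  rewrite ler_wpM2l// -[10^-1]mul1r; apply: le_trans h1.
  by rewrite ler_peMl.
rewrite difference_sum//; last exact: ltnW.
apply: le_trans (nrm_triangle nrmP _ _) _.
have bound1 := @young_bound w (fun j mu => f mu (x j) - f mu (xt j))
  (F * (H + 2 * S)) (H + 2 * S) (F * S) s t st tN.
have bound2 := @young_bound h (fun j mu => f mu (xt j)) (F * 2) (B * 2) F s t st tN.
apply: le_trans (lerD (bound1 _ _ _ _) (bound2 _ _ _ _)) _.
- by lra.
- move=> i j mu si ij jt; apply: le_trans (field_difference _ _ _) _.
  rewrite -!mulrA -mulrDr ler_wpM2l// mulrDl lerD//.
    exact: (IH j jt i (leq_trans ks si) (ltnW ij) (leq_trans (ltnW jt) tl)).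
  rewrite [2 * S]mulrC -mulrA ler_pM ?(nrm_ge0 nrmP)//.
    exact: (eS i (leq_trans ks si) (ltn_trans ij jt)).
  exact: (xtW j i (leq_trans ks si) (ltnW ij) (leq_trans (ltnW jt) tl)).
- move=> i j si ij jt; rewrite mulrAC mulrC ler_wpM2l//; first by lra.
  exact: (wW ij (leq_trans jt tN)).
- move=> mu; apply: le_trans (field_lipschitz nrmP fP mu _ _) _.
  by rewrite ler_wpM2l// eS.
- by lra.
- move=> i j mu si ij jt; apply: le_trans (field_lipschitz nrmP fP mu _ _) _.
  rewrite -mulrA ler_wpM2l//.
  exact: (xtW j i (leq_trans ks si) (ltnW ij) (leq_trans (ltnW jt) tl)).
- move=> i j si ij jt; rewrite mulrAC [leRHS]mulrAC ler_pM2r//.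
  exact: (hW ij (leq_trans jt tN)).
- by move=> mu; exact: field_le.
have h1 := wW st tN.
have h2 := hW st tN.
have h3 := ler_wpM2l W0 (W_small ks (ltnW st) tl small).
have h4 := ler_wpM2r S0 h1.
move: h2 h3 h4; rewrite expr2; move: (C) (W s t) W0 (l1v _) (l1v _) => c v v0 a b h2 h3 h4.
have K0 : 0 <= H + 2 * S + B * 2 by lra.
have h5 := ler_wpM2l K0 h3.
have -> : F * S * a + (H + 2 * S) * c * (v * v) + (F * b + B * 2 * c * (v * v)) =
  F * a * S + F * b + (H + 2 * S + B * 2) * (v * (c * v)) by ring.
(* In terms of [nrm (e k) + B], the coefficient of [v] on the left is at most [164/100], while [H]
   is [2]: this closes the induction. *)
have h6 : v * S + B * v + (H + 2 * S + B * 2) * (v * (1 / 10)) <= H * v.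
  have -> : v * S + B * v + (H + 2 * S + B * 2) * (v * (1 / 10)) =
     (S + B + (H + 2 * S + B * 2) * (1 / 10)) * v by ring.
  by rewrite ler_wpM2r// SE HE; lra.
lra.
Qed.

Local Notation P := (B * al `^ p^-1).
Local Notation E j := (nrm (e j) + P).

Lemma local_growth k l : (k <= l)%N -> (l <= N)%N -> om k l <= al -> E l <= 3 * E k.
Proof.
move=> kl lN small.
have H := local_difference kl lN small (leqnn k) kl (leqnn l).
have W0 := powR_ge0 (om k l) p^-1.
have a0 := powR_ge0 al p^-1.
have P0 : 0 <= P by rewrite mulr_ge0.
have Wa : W k l <= al `^ p^-1.
  by rewrite ge0_ler_powR ?nnegrE ?(control_ge0 omP) ?invr_ge0 ?(ltW p_gt0) ?(ltW al_gt0).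
have a1 : al `^ p^-1 <= 1 / 10 by apply: le_trans Cal; rewrite ler_peMl.
have ek0 := nrm_ge0 nrmP (e k).
have el : nrm (e l) <= nrm (e k) + nrm (e l - e k).
  by rewrite -{1}(subrK (e k) (e l)) addrC; exact: nrm_triangle.
have K0 : 0 <= 2 * (nrm (e k) + B) by rewrite mulr_ge0// addr_ge0.
have h1 := ler_wpM2l K0 Wa.
have h2 := ler_wpM2l ek0 a1.
lra.
Qed.

Hypothesis hP : forall a b, (a < b)%N -> (b <= N)%N -> F * l1v (incr h a b) <= P.
Hypotheses (p_ge1 : 1 <= p) (al_le1 : al <= 1).

(** Covers single steps of arbitrarily large control, read off the recursion directly. *)
Lemma step_growth k : (k < N)%N -> E k.+1 <= (2 + W k k.+1) * E k.
Proof.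
move=> kN; have F0 : 0 <= F by exact: C3b_norm_ge0.
have ek0 := nrm_ge0 nrmP (e k).
have W0 := powR_ge0 (om k k.+1) p^-1.
have P0 : 0 <= P by rewrite mulr_ge0// powR_ge0.
have := difference_sum (leqnSn k) kN; rewrite !big_nat1 => eE.
have h0 : nrm (e k.+1) <= nrm (e k) + nrm (e k.+1 - e k).
  by rewrite -{1}(subrK (e k) (e k.+1)) addrC; exact: nrm_triangle.
have h1 : nrm (e k.+1 - e k) <=
    F * nrm (e k) * l1v (incr w k k.+1) + F * l1v (incr h k k.+1).
  rewrite eE; apply: le_trans (nrm_triangle nrmP _ _) _; apply: lerD.
    by apply: nrm_lincomb_le => mu; exact: field_lipschitz.
  by apply: (@nrm_lincomb_le (incr h k k.+1)) => mu; exact: field_le.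
have h2 := ler_wpM2l ek0 (wW (ltnSn k) kN).
have h3 := hP (ltnSn k) kN.
have h4 := mulr_ge0 W0 P0.
lra.
Qed.

(** Greedy splitting: cut at the first [j.+1] with [om k j.+1 > al], use [local_growth] up to [j]
    and [step_growth] for the last step, then continue from [j.+1]. The leading [3] pays for the
    final interval of small control. *)
Lemma gronwall k l : (k <= l)%N -> (l <= N)%N ->
  E l <= 3 * expR (8 / al * om k l) * E k.
Proof.
have Ege0 j : 0 <= E j by rewrite addr_ge0 ?(nrm_ge0 nrmP)// mulr_ge0// powR_ge0.
move: {2}(l - k)%N (leqnn (l - k)) => m; elim: m k => [|m IH] k lkm kl lN.
  have -> : l = k by clear -lkm kl; lia.
  have := Ege0 k; have : 1 <= expR (8 / al * om k k).
    by rewrite -[leLHS]expR0 ler_expR mulr_ge0 ?(control_ge0 omP)// divr_ge0// ltW.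
  by move=> h1 h2; rewrite ler_peMl//; lra.
have [small|big] := leP (om k l) al.
  apply: le_trans (local_growth kl lN small) _; rewrite ler_wpM2r// ler_peMr//.
  by rewrite -[leLHS]expR0 ler_expR mulr_ge0 ?(control_ge0 omP)// divr_ge0// ltW.
have exj : exists j, (k <= j)%N && (al < om k j) by exists l; rewrite kl.
case: (ex_minnP exj) => j /andP[kj aj] jmin.
have jl : (j <= l)%N by apply: jmin; rewrite kl.
(* Superadditivity at [k, k, k] forces [om k k <= 0], so the threshold is not exceeded at [k]
   itself. *)
have {}kj : (k < j)%N.
  rewrite ltn_neqAle kj andbT; apply/eqP => kjE; move: aj; rewrite -kjE.
  have := omP.2 k k k; rewrite leqnn => /(_ isT) h1 h2.
  by have := al_gt0; lra.
case: j kj aj jmin jl => // j kj aj jmin jl.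
have smallj : om k j <= al.
  by rewrite leNgt; apply/negP => hj; have := jmin j; rewrite hj ltnn -ltnS kj => /(_ isT).
have hl := local_growth (kj : (k <= j)%N) (ltnW (leq_trans jl lN)) smallj.
have hs := step_growth (leq_trans jl lN).
pose v := om k j.+1 / al.
have v1 : 1 <= v by rewrite ler_pdivlMr// mul1r ltW.
(* Uses [al <= 1] to pass from [om k j.+1] to [v], then [1 <= v] and [1 <= p] to drop the root. *)
have Wv : W j j.+1 <= v.
  apply: (@le_trans _ _ (W k j.+1)); first exact: W_mono.
  apply: (@le_trans _ _ (v `^ p^-1)).
    rewrite ge0_ler_powR ?nnegrE ?(control_ge0 omP) ?invr_ge0 ?(ltW p_gt0)//.
      by rewrite divr_ge0 ?(control_ge0 omP)// ltW.
    by rewrite ler_pdivlMr// ler_piMr// (control_ge0 omP).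
  by apply: ler1_powR => //; rewrite invf_le1.
(* Origin of the [8]: from [W j j.+1 <= v] and [1 <= v], the factor [3 * (2 + W j j.+1)] is at most
   [6 + 3 * v <= 1 + 8 * v <= expR (8 * v)]. *)
have hj : E j.+1 <= expR (8 / al * om k j.+1) * E k.
  apply: le_trans hs _.
  have -> : 8 / al * om k j.+1 = 8 * v by rewrite /v; ring.
  have hx := expR_ge1Dx (8 * v).
  apply: le_trans (ler_wpM2l _ hl) _; first by rewrite addr_ge0// powR_ge0.
  by rewrite mulrA ler_wpM2r//; lra.
have ljm : (l - j.+1 <= m)%N by clear -lkm kj jl; lia.
apply: le_trans (IH j.+1 ljm jl lN) _.
rewrite -mulrA -[leRHS]mulrA ler_wpM2l//.
apply: le_trans (ler_wpM2l (expR_ge0 _) hj) _.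
rewrite mulrA ler_wpM2r// -expRD ler_expR -mulrDr ler_wpM2l ?divr_ge0 ?(ltW al_gt0)//.
by rewrite addrC omP.2// ltnW// kj.
Qed.

End Young.

(** * Comparison with the explicit constants *)

Section Constants.
Variables (R : realType) (p : R) (N : nat).
Hypothesis p_ge2 : 2 <= p.

Lemma inv_p_bounds : 0 < p^-1 /\ p^-1 <= 1 / 2.
Proof.
have p0 : 0 < p by have := p_ge2; lra.
split; first by rewrite invr_gt0.
by rewrite div1r lef_pV2 ?posrE.
Qed.

Lemma powR_ge1 (a y : R) : 1 <= a -> 0 <= y -> 1 <= a `^ y.
Proof. by move=> a1 y0; rewrite -(powRr0 a) ler_powR. Qed.

Lemma C_pN_ge1 : (0 < N)%N -> 1 <= C_pN p N.
Proof.
move=> N0; have [p0 p1] := inv_p_bounds.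
have z1 : 1 <= zetaN N (2 / p).
  rewrite /zetaN big_ltn// powR1 lerDl sumr_ge0// => i _; exact: powR_ge0.
have t1 : 1 <= 2 `^ (2 / p) :> R by apply: powR_ge1; lra.
by rewrite /C_pN; have := ler_pM ler01 ler01 t1 z1; rewrite mulr1.
Qed.

(** As [1 / p <= 1 / 2], the exponent of [2] is at least [3], which yields [9 * 8]. *)
Lemma K_p_ge72 : 72 <= K_p p N.
Proof.
have [p0 p1] := inv_p_bounds.
have t : 2 `^ 3 <= 2 `^ (6 * (1 - 1 / p)) :> R by rewrite ler_powR//; lra.
have {}t : 8 <= 2 `^ (6 * (1 - 1 / p)) :> R.
  by apply: le_trans t; rewrite powR_mulrn//; lra.
rewrite /K_p; set M := Num.max _ _; have M1 : 1 <= M by rewrite le_max lexx.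
rewrite -[leLHS]mulr1 ler_pM//; lra.
Qed.

(** The exponent [1 - 1 / p] is at least [1 / 2], so the second entry of the maximum dominates the
    square root of [C_pN]; the other powers are at least [1]. *)
Lemma K_p_sqr_ge : 1 <= C_pN p N -> 81 * C_pN p N <= K_p p N ^+ 2.
Proof.
move=> C1; have [p0 p1] := inv_p_bounds.
have C0 : 0 <= C_pN p N by lra.
have -> : 81 * C_pN p N = (9 * C_pN p N `^ (2^-1)) ^+ 2.
  by rewrite exprMn -(powR_mulrn 2 (powR_ge0 _ _)) -powRrM mulVf// powRr1//; ring.
have K0 : 0 <= K_p p N by have := K_p_ge72; lra.
have s0 : 0 <= 9 * C_pN p N `^ 2^-1 by rewrite mulr_ge0// powR_ge0.
rewrite ler_sqr ?nnegrE//.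
rewrite /K_p -mulrA ler_wpM2l//.
have t1 : 1 <= 2 `^ (6 * (1 - 1 / p)) :> R by apply: powR_ge1; lra.
have t2 : 1 <= 6 `^ (1 - 1 / p) :> R by apply: powR_ge1; lra.
have t3 : 1 <= 8 `^ ((1 - 1 / p) * (1 - 2 / p)) :> R.
  by apply: powR_ge1; rewrite ?mulr_ge0//; lra.
have t4 : C_pN p N `^ 2^-1 <= C_pN p N `^ (1 - 1 / p) by rewrite ler_powR//; lra.
rewrite -[leLHS]mul1r ler_pM ?powR_ge0//; rewrite le_max; apply/orP; right.
rewrite -[leLHS]mul1r ler_pM ?powR_ge0//.
by rewrite -[leLHS]mul1r ler_pM ?powR_ge0//.
Qed.

Lemma K'_p_ge : 3 * (1 + K_p p N ^+ 2) <= K'_p p N.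
Proof.
have [p0 p1] := inv_p_bounds.
have t1 : 1 <= 2 `^ (1 - 2 / p) :> R by apply: powR_ge1; lra.
rewrite /K'_p ler_wpM2r//; last by lra.
by rewrite addr_ge0// sqr_ge0.
Qed.

Lemma L_p_ge0 : 0 <= L_p p N.
Proof. by rewrite !mulr_ge0 ?powR_ge0// sumr_ge0// => i _; exact: powR_ge0. Qed.

Local Notation X := (L_p p N + K_p p N ^+ 2 + K'_p p N).

Lemma c_pN_ge : (2 * X) `^ p <= c_pN p N.
Proof.
have K'0 := K'_p_ge; have L0 := L_p_ge0; have K0 := sqr_ge0 (K_p p N).
have p2 := p_ge2.
rewrite /c_pN powRM//; last by lra.
rewrite ler_wpM2r ?powR_ge0// ler_peMr ?powR_ge0//.
by rewrite -[leLHS]expR0 ler_expR; lra.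
Qed.

Lemma c_pN_ge_C : 1 <= C_pN p N -> 8 * (10 * C_pN p N) `^ p <= c_pN p N.
Proof.
move=> C1; have p2 := p_ge2; apply: le_trans c_pN_ge.
have K'0 := K'_p_ge; have L0 := L_p_ge0; have K0 := K_p_sqr_ge C1.
have e8 : 8 <= 8 `^ p :> R by apply: le1r_powR; lra.
apply: le_trans (ler_wpM2r (powR_ge0 _ _) e8) _.
rewrite -powRM; [|lra|lra].
rewrite ge0_ler_powR ?nnegrE; lra.
Qed.

(** The [p]-th root of [c_pN] is at least [2 * X], which exceeds [8 * K_p ^+ 2]. *)
Lemma c'_pN_ge : 8 * 72 ^+ 2 <= c'_pN p N.
Proof.
have [p0 p1] := inv_p_bounds.
have K'0 := K'_p_ge; have L0 := L_p_ge0; have K0 := K_p_ge72.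
have K2 : 72 ^+ 2 <= K_p p N ^+ 2.
  by rewrite ler_sqr ?nnegrE//; lra.
have t1 : 1 <= 2 `^ (1 - 2 / p) :> R by apply: powR_ge1; lra.
have p2 := p_ge2.
rewrite /c'_pN -[leLHS]mul1r ler_pM ?mulr_ge0 ?exprn_ge0//; apply: (@le_trans _ _ (((2 * X) `^ p) `^ (1 / p))).
  rewrite -powRrM div1r divff ?powRr1; lra.
rewrite ge0_ler_powR ?nnegrE ?powR_ge0 ?c_pN_ge//; first by lra.
by apply: le_trans (powR_ge0 _ _) c_pN_ge.
Qed.

(** From [1 - 1 / 4 <= expR (- (1 / 4))] one gets [expR (1 / 4) <= 4 / 3]; five squarings, rounded
    upwards, reach [8]. *)
Lemma expR8_le : expR 8 <= 103 ^+ 2 :> R.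
Proof.
have sq (a b : R) : expR a <= b -> expR (2 * a) <= b ^+ 2.
  move=> ab; rewrite expRM_natl ler_sqr ?nnegrE ?expR_ge0//.
  exact: le_trans (expR_ge0 _) ab.
have h0 : expR (1 / 4) <= 4 / 3 :> R.
  have := expR_ge1Dx (- (1 / 4) : R); rewrite expRN => h.
  by rewrite -[leLHS]invrK -[leRHS]invrK lef_pV2 ?posrE ?invr_gt0 ?expR_gt0//; lra.
have h1 : expR (1 / 2) <= 178 / 100 :> R.
  by have := sq _ _ h0; rewrite (_ : 2 * (1 / 4) = 1 / 2); [lra|field].
have h2 : expR 1 <= 317 / 100 :> R.
  by have := sq _ _ h1; rewrite (_ : 2 * (1 / 2) = 1); [lra|field].
have h3 : expR 2 <= 101 / 10 :> R.
  by have := sq _ _ h2; rewrite mulr1; lra.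
have h4 : expR 4 <= 103 :> R.
  by have := sq _ _ h3; rewrite -natrM; lra.
by have := sq _ _ h4; rewrite -natrM; lra.
Qed.

Lemma c'_pN_ge_expR8 : 3 * expR 8 <= 2 * c'_pN p N.
Proof. by have := c'_pN_ge; have := expR8_le; lra. Qed.

End Constants.

(** * Choice of the control and the global estimate *)

Section Main.
Variables (R : realType) (p : R) (N d n : nat) (nrm : 'rV[R]_n -> R).
Variables (f : 'I_d -> 'rV[R]_n -> 'rV[R]_n) (w wt : nat -> 'I_d -> R).
Variables (x xt : nat -> 'rV[R]_n).
Hypotheses (p_ge2 : 2 <= p) (d_gt0 : (0 < d)%N) (nrmP : is_norm nrm) (fP : is_C3b nrm f).
Hypotheses (xw : solves N f x w) (xtwt : solves N f xt wt) (N_gt0 : (0 < N)%N).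
Local Notation F := (C3b_norm nrm f).
Local Notation h := (fun j mu => w j mu - wt j mu).
Local Notation V u := (pvarq p (fun a b => l1v (incr u a b))).
Local Notation C := (C_pN p N).

Lemma difference_bound k : (k <= N)%N ->
  nrm (x k - xt k) <= 3 * expR 8 *
    expR (8 * (10 * C) `^ p * (F `^ p * (V w 0 N + V wt 0 N))) *
    (nrm (x 0%N - xt 0%N) + F * var_path p h 0 N).
Proof.
move=> kN; have p_gt0 : 0 < p by have := p_ge2; lra.
have r_ge0 : 0 <= p^-1 by rewrite invr_ge0 ltW.
have C1 : 1 <= C := C_pN_ge1 p_ge2 N_gt0.
have F0 : 0 <= F := C3b_norm_ge0 nrmP fP d_gt0.
have V0 (u : nat -> 'I_d -> R) a b : 0 <= V u a b by exact: pvarq_ge0.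
have Vc (u : nat -> 'I_d -> R) : is_control (V u) by exact: pvarq_control.
have [al alE] : {al : R | al = (10 * C) `^ (- p)} by eexists.
have al_gt0 : 0 < al by rewrite alE powR_gt0//; lra.
have alV : al^-1 = (10 * C) `^ p by rewrite alE powRN invrK.
have al_root : al `^ p^-1 = (10 * C)^-1.
  by rewrite alE -powRrM mulNr divff ?gt_eqF// powR_inv1//; lra.
have Cal : C * al `^ p^-1 <= 1 / 10.
  by rewrite al_root invfM mulrCA divff ?mulr1 ?div1r//; lra.
have al_le1 : al <= 1.
  by rewrite -[al]invrK alV invf_le1 ?powR_gt0//; [apply: powR_ge1|]; lra.
(* The last summand has mass at most [al] on [[0, N]], so it adds at most [8] to the exponent in
   [gronwall]: hence the prefactor [expR 8]. *)
pose om a b := F `^ p * (V w a b + V wt a b) + al * (V h a b / V h 0 N).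
have nu0 a b : 0 <= V h a b / V h 0 N by rewrite divr_ge0.
have Fp0 := powR_ge0 F p.
have omP : is_control om.
  split=> [a b|a b c abc].
    by rewrite addr_ge0// mulr_ge0// ?addr_ge0// ltW.
  have h1 := (Vc w).2 a b c abc; have h2 := (Vc wt).2 a b c abc.
  have h3 := (Vc h).2 a b c abc.
  rewrite /om addrACA -!mulrDr -mulrDl; apply: lerD.
    apply: ler_wpM2l => //; rewrite addrACA; exact: lerD h1 h2.
  apply: ler_wpM2l; first exact: ltW.
  by apply: ler_wpM2r; [rewrite invr_ge0; exact: V0|exact: h3].
have FpE (u : nat -> 'I_d -> R) a b : F * V u a b `^ p^-1 = (F `^ p * V u a b) `^ p^-1.
  by rewrite powRM// -powRrM divff ?gt_eqF// powRr1.
have Vle (u : nat -> 'I_d -> R) a b : (a < b)%N ->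
    F * l1v (incr u a b) <= F * V u a b `^ p^-1.
  move=> ab; rewrite ler_wpM2l//.
  by apply: (@le_pvarq_root _ _ (fun a b => l1v (incr u a b))) => //; exact: l1v_ge0.
have om0 a b : 0 <= om a b := omP.1 a b.
have wW a b : (a < b)%N -> (b <= N)%N -> F * l1v (incr w a b) <= om a b `^ p^-1.
  move=> ab bN; apply: le_trans (Vle w a b ab) _.
  rewrite FpE ge0_ler_powR ?nnegrE ?mulr_ge0// /om mulrDr -addrA lerDl.
  by rewrite addr_ge0// mulr_ge0// ltW.
have wtW a b : (a < b)%N -> (b <= N)%N -> F * l1v (incr wt a b) <= om a b `^ p^-1.
  move=> ab bN; apply: le_trans (Vle wt a b ab) _.
  rewrite FpE ge0_ler_powR ?nnegrE ?mulr_ge0// /om mulrDr addrAC lerDr.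
  by rewrite addr_ge0// mulr_ge0// ltW.
have P0 : 0 <= F * V h 0 N `^ p^-1 by rewrite mulr_ge0// powR_ge0.
have ar0 : 0 < al `^ p^-1 by rewrite powR_gt0.
have [B BE] : {B : R | B = F * V h 0 N `^ p^-1 / al `^ p^-1} by eexists.
have B0 : 0 <= B by rewrite BE divr_ge0// ltW.
have BP : B * al `^ p^-1 = F * V h 0 N `^ p^-1 by rewrite BE divfK// gt_eqF.
have Vmono a b : (a < b)%N -> (b <= N)%N -> V h a b <= V h 0 N.
  by move=> ab bN; apply: (control_mono (Vc h)) => //; exact: ltnW.
have hW a b : (a < b)%N -> (b <= N)%N -> F * l1v (incr h a b) <= B * om a b `^ p^-1.
  move=> ab bN; apply: le_trans (Vle h a b ab) _.
  apply: (@le_trans _ _ (B * (al * (V h a b / V h 0 N)) `^ p^-1)); last first.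
    apply: ler_wpM2l => //; apply: ge0_ler_powR; rewrite ?nnegrE//.
      by apply: mulr_ge0; [exact: ltW|exact: nu0].
    by rewrite /om lerDr; apply: mulr_ge0 => //; apply: addr_ge0.
  rewrite powRM ?(ltW al_gt0)// mulrA BP -mulrA ler_wpM2l// -powRM//.
  (* If [V h 0 N = 0] the quotient is [0] by convention, and monotonicity makes [V h a b] vanish as
     well. *)
  rewrite mulrCA; have [V00|V00] := eqVneq (V h 0 N) 0; last by rewrite divff// mulr1.
  have -> : V h a b = 0 by apply/eqP; rewrite eq_le V0 andbT -V00 Vmono.
  by rewrite mul0r.
have hP a b : (a < b)%N -> (b <= N)%N -> F * l1v (incr h a b) <= B * al `^ p^-1.
  move=> ab bN; apply: le_trans (Vle h a b ab) _.
  by rewrite BP ler_wpM2l// ge0_ler_powR ?nnegrE ?Vmono.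
have p_ge1 : 1 <= p by have := p_ge2; lra.
have := gronwall nrmP p_gt0 omP fP d_gt0 al_gt0 C1 Cal xw xtwt B0 wW wtW hW hP
  p_ge1 al_le1 (leq0n k) kN.
rewrite BP => G; apply: le_trans (_ : _ <= nrm (x k - xt k) + F * V h 0 N `^ p^-1) _.
  by rewrite lerDl.
apply: le_trans G _; rewrite /var_path /pvar -/(V h 0 N).
rewrite ler_wpM2r ?addr_ge0 ?(nrm_ge0 nrmP)// -[leRHS]mulrA ler_wpM2l//.
rewrite -expRD ler_expR -alV.
apply: le_trans (ler_wpM2l _ (control_mono omP (leqnn 0) (leq0n k) kN)) _.
  by rewrite divr_ge0// ltW.
rewrite /om mulrDr addrC lerD//.
have [V00|V00] := eqVneq (V h 0 N) 0.
  by rewrite V00 invr0 !mulr0.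
by rewrite divff// mulr1 divfK// gt_eqF.
Qed.

End Main.

Theorem theorem5p10 (R : realType) (p : R) (N d n : nat)
  (nrm : 'rV[R]_n -> R) (f : 'I_d -> 'rV[R]_n -> 'rV[R]_n)
  (w wt : nat -> 'I_d -> R) (xi xit : 'rV[R]_n) (x xt : nat -> 'rV[R]_n) :
  2 <= p -> p < 3 -> (1 <= d)%N -> (1 <= n)%N ->
  is_norm nrm -> is_C3b nrm f ->
  x 0%N = xi ->
  (forall k, (k < N)%N ->
     x k.+1 = x k + \sum_(mu < d) (w k.+1 mu - w k mu) *: f mu (x k)) ->
  xt 0%N = xit ->
  (forall k, (k < N)%N ->
     xt k.+1 = xt k + \sum_(mu < d) (wt k.+1 mu - wt k mu) *: f mu (xt k)) ->
  forall k, (k <= N)%N ->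
    nrm (x k - xt k) <=
      2 * c'_pN p N
      * expR (c_pN p N * C3b_norm nrm f `^ p
              * (rp_norm p w 0 N `^ p + rp_norm p wt 0 N `^ p))
      * (nrm (xi - xit) + C3b_norm nrm f * rp_dist p w wt N).
Proof.
move=> p2 _ d1 _ nrmP fP <- xw <- xtwt k kN.
have p0 : 0 < p by lra.
have F0 : 0 <= C3b_norm nrm f := C3b_norm_ge0 nrmP fP d1.
have c'8 := c'_pN_ge_expR8 N p2.
have c'1 : 1 <= 2 * c'_pN p N by have := expR_ge1Dx (8 : R); lra.
have c0 : 0 <= c_pN p N := le_trans (powR_ge0 _ _) (c_pN_ge N p2).
set e0 := nrm (x 0%N - xt 0%N); have e00 : 0 <= e0 by exact: nrm_ge0.
set D := rp_dist p w wt N; have D0 : 0 <= D by rewrite addr_ge0// powR_ge0.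
have FD0 := mulr_ge0 F0 D0.
(* For [N = 0] the zeta sum is empty and [1 <= C_pN p N] fails; there [k = 0], and it suffices that
   the prefactors are at least [1]. *)
have [N0|N0] := posnP N.
  have -> : k = 0%N by move: kN; rewrite N0 leqn0 => /eqP.
  rewrite -/e0; set y := c_pN p N * _ * _.
  have y0 : 0 <= y by rewrite !mulr_ge0 ?addr_ge0 ?powR_ge0.
  have ey : 1 <= expR y by rewrite -[leLHS]expR0 ler_expR.
  apply: (@le_trans _ _ (1 * (e0 + C3b_norm nrm f * D))); first by lra.
  apply: ler_wpM2r; first exact: addr_ge0.
  exact: mulr_ege1.
apply: le_trans (difference_bound p2 d1 nrmP fP xw xtwt N0 kN) _.
have vle (u : nat -> 'I_d -> R) :
    pvarq p (fun a b => l1v (incr u a b)) 0 N <= rp_norm p u 0 N `^ p.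
  rewrite -pvar_powR// ge0_ler_powR ?nnegrE ?powR_ge0 ?addr_ge0 ?powR_ge0 ?(ltW p0)//.
  by rewrite /rp_norm lerDl powR_ge0.
have v0 (u : nat -> 'I_d -> R) : 0 <= pvarq p (fun a b => l1v (incr u a b)) 0 N.
  exact: pvarq_ge0.
(* Factor by factor: the prefactor by [c'_pN_ge_expR8], the exponent by [c_pN_ge_C] and [vle], the
   distance by dropping its second-level term. *)
apply: ler_pM; rewrite ?mulr_ge0 ?expR_ge0 ?addr_ge0 ?mulr_ge0 ?powR_ge0//.
  apply: ler_pM; rewrite ?mulr_ge0 ?expR_ge0//.
  rewrite ler_expR -[leRHS]mulrA.
  have v2 := addr_ge0 (v0 w) (v0 wt).
  apply: le_trans (ler_wpM2r _ (c_pN_ge_C p2 (C_pN_ge1 p2 N0))) _.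
    exact: mulr_ge0 (powR_ge0 _ _) v2.
  apply: ler_wpM2l; first exact: c0.
  by apply: ler_wpM2l; [exact: powR_ge0|exact: lerD (vle w) (vle wt)].
rewrite lerD2l; apply: ler_wpM2l; first exact: F0.
by rewrite lerDl powR_ge0.
Qed.
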